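(* Assume $\mathbb{E}\min(Z,W)=\infty$ and $\sum_{n\ge0} r_n^2<\infty$. Then $\Lambda_n\to\infty$ in probability as $n\to\infty$.
   Context: Let $Z,W,(Z_n)_{n\ge1},(W_n)_{n\ge1}$ be independent, identically distributed random variables taking values in $\mathbb{N}=\{1,2,3,\dots\}$. Define sets $T_n\subset\mathbb{Z}$ recursively by $T_n=\{n\}$ for $n\le 0$ and $T_n=\{n\}\cup T_{n-Z_n}\cup T_{n-W_n}$ for $n\ge1$. Let $\mathcal{L}_n=T_n\cap\{0,-1,-2,\dots\}$ and $\Lambda_n=|\mathcal{L}_n|$. Define the $Z$-chain $T^Z_n=\{n\}$ for $n\le0$ and $T^Z_n=\{n\}\cup T^Z_{n-Z_n}$ for $n\ge1$. Let $r_0=1$ and $r_n=\mathbb{P}(0\in T^Z_n)$ for $n\ge1$; equivalently $r_n=\sum_{i=1}^n q_i r_{n-i}$ with $q_i=\mathbb{P}(Z=i)$. *)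

(* Defs.v *)
From HB Require Import structures.
From mathcomp Require Import all_boot all_order all_algebra.
From mathcomp Require Import all_classical all_reals all_analysis.
Set Implicit Arguments. Unset Strict Implicit. Unset Printing Implicit Defensive.
Import Order.TTheory GRing.Theory Num.Theory.
Local Open Scope classical_set_scope.
Local Open Scope ring_scope.

(* Combined family indexed by i : nat: X (2k) = Z_(k+1), X (2k+1) = W_(k+1).
   This enumerates exactly Z_1, W_1, Z_2, W_2, ... (index 0 of Z, W unused). *)
Definition ZWfam {T : Type} (Z W : nat -> T -> nat) (i : nat) : T -> nat :=
  if odd i then W (i./2).+1 else Z (i./2).+1.

Definition mutually_independent {d : measure_display} {T : measurableType d}
  {R : realType} (P : probability T R) (X : nat -> T -> nat) : Prop :=
  forall (J : seq nat) (A : nat -> set nat), uniq J ->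
    P (\big[setI/setT]_(i <- J) (X i @^-1` A i)) =
    (\prod_(i <- J) P (X i @^-1` A i))%E.

Definition identically_distributed {d : measure_display} {T : measurableType d}
  {R : realType} (P : probability T R) (X : nat -> T -> nat) : Prop :=
  forall i j (k : nat), P [set x | X i x = k] = P [set x | X j x = k].

(* T_m (for one fixed outcome, with z = (Z_n)_n, w = (W_n)_n) unfolded
   `fuel` times along the recursion T_m = {m} u T_{m - Z_m} u T_{m - W_m}
   for m >= 1, T_m = {m} for m <= 0.  Since Z_n, W_n >= 1, for 0 <= m <= fuel
   the unfolding reaches nonpositive indices before the fuel runs out, so
   Tfuel z w n n (n : nat) lists exactly the elements of T_n. *)
Fixpoint Tfuel (z w : nat -> nat) (fuel : nat) (m : int) : seq int :=
  if fuel is f.+1 then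
    (if m <= 0 then [:: m]
     else m :: (Tfuel z w f (m - (z `|m|%N)%:Z) ++ Tfuel z w f (m - (w `|m|%N)%:Z)))
  else [:: m].

Definition Tset (z w : nat -> nat) (n : nat) : seq int :=
  undup (Tfuel z w n n%:Z).

Definition Lset (z w : nat -> nat) (n : nat) : seq int :=
  [seq m <- Tset z w n | m <= 0].

Definition Lambda {T : Type} (Z W : nat -> T -> nat) (n : nat) (x : T) : nat :=
  size (Lset (fun k => Z k x) (fun k => W k x) n).

(* r_0 = 1, r_n = sum_{i=1}^n q_i r_{n-i}; rlist q n = [:: r_0; ...; r_n]. *)
Fixpoint rlist {R : realType} (q : nat -> R) (n : nat) : seq R :=
  if n is n'.+1 then
    let s := rlist q n' in
    rcons s (\sum_(1 <= i < n'.+2) q i * nth 0 s (n'.+1 - i))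
  else [:: 1].

Definition rseq {R : realType} (q : nat -> R) (n : nat) : R := nth 0 (rlist q n) n.

(* q_i = P(Z = i), here with Z := Z_1 (all Z_n, W_n share this law). *)
Definition qlaw {d : measure_display} {T : measurableType d} {R : realType}
  (P : probability T R) (Z : T -> nat) (i : nat) : R :=
  fine (P [set x | Z x = i]).

(* Main.v *)
Require Import Defs.
From HB Require Import structures.
From mathcomp Require Import all_boot all_order all_algebra.
From mathcomp Require Import all_classical all_reals all_analysis.
From mathcomp Require Import zify ring lra.
Set Implicit Arguments.
Unset Strict Implicit. Unset Printing Implicit Defensive.
Import Order.TTheory GRing.Theory Num.Theory.
Local Open Scope classical_set_scope.
Local Open Scope ring_scope.

(* Let [h n = P(Lambda_n <= K)] and [H_C n] the probability that the union of the
   leaf sets of [n - c], [c] in [C], has at most [K] elements.  Splitting on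
   [(Z_n, W_n)] and keeping only one child except on the event [Z_n = a, W_n = b]
   gives, for [0 < q_a, q_b] and [0] not in [C],
     [limsup H_(0 :: C) <= (1 - q_a q_b) limsup h + q_a q_b limsup H_(a :: b :: C)].
   As [E min(Z, W) = oo] makes the support of [q] unbounded, iterating this yields
   [limsup h <= (1 - k) limsup h + k limsup H_(0 :: C)] for some [k > 0] and some [C]
   of [K + 1] points at mutual distance at least [D].  The Z-chains started at two
   points at distance [m] end at the same leaf with probability at most
   [sum_j r_j r_(j + m)], the expected number of common points of two independent
   renewal chains, and this tends to [0] as [m] grows because [sum r_n^2 < oo].
   So [limsup H_C] is small, and so is [limsup h]. *)

(** * Leaf sets and Z-chains of one fixed outcome *)

Definition positive_jumps (z : nat -> nat) := forall k, (0 < k)%N -> (0 < z k)%N.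

Definition agree (n : nat) (z z' : nat -> nat) :=
  forall k, (0 < k <= n)%N -> z k = z' k.

(** A list with repetitions, so that the recursion is a plain concatenation; [nleaves] removes the
    duplicates. *)
Definition leaves (z w : nat -> nat) (m : int) : seq int :=
  [seq v <- Tfuel z w `|m|%N m | v <= 0].

Fixpoint landing_fuel (z : nat -> nat) (fuel : nat) (m : int) : int :=
  if fuel is f.+1 then
    (if m <= 0 then m else landing_fuel z f (m - (z `|m|%N)%:Z))
  else m.

(* The unique element of [T^Z_m] in [(-oo, 0]]. *)
Definition landing (z : nat -> nat) (m : int) : int := landing_fuel z `|m|%N m.

(* [#|U_(c in C) L_(n - c)|]; the points are coded by their distance to [n],
   which makes the recursion below invariant under translation. *)
Definition nleaves (z w : nat -> nat) (n : nat) (C : seq nat) : nat :=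
  size (undup (flatten [seq leaves z w (n%:Z - c%:Z) | c <- C])).

Lemma Tfuel_le0 z w f (m : int) : m <= 0 -> Tfuel z w f m = [:: m].
Proof. by case: f => //= f ->. Qed.

(** Each jump lowers the index by at least 1, so fuel [m] already suffices to reach the nonpositive
    indices. *)
Lemma Tfuel_stable z w f f' (m : int) :
  positive_jumps z -> positive_jumps w -> m <= f%:Z -> m <= f'%:Z ->
  Tfuel z w f m = Tfuel z w f' m.
Proof.
move=> zp wp; elim: f f' m => [|f IH] [|f'] m mf mf'; rewrite ?(Tfuel_le0 _ _ _ mf)
  ?(Tfuel_le0 _ _ _ mf') //=.
case: ifPn => // m0.
have /zp z0 : (0 < `|m|)%N by lia.
have /wp w0 : (0 < `|m|)%N by lia.
by rewrite (IH f' (m - _)) ?(IH f' (m - (w _)%:Z)) //; lia.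
Qed.

Lemma landing_fuel_stable z f f' (m : int) :
  positive_jumps z -> m <= f%:Z -> m <= f'%:Z ->
  landing_fuel z f m = landing_fuel z f' m.
Proof.
move=> zp; elim: f f' m => [|f IH] [|f'] m mf mf' //=; case: ifPn => // m0; try lia.
have /zp z0 : (0 < `|m|)%N by lia.
by apply: IH; lia.
Qed.

Lemma leaves_le0 z w (m : int) : m <= 0 -> leaves z w m = [:: m].
Proof. by move=> m0; rewrite /leaves Tfuel_le0 //= m0. Qed.

Lemma leaves_gt0 z w (n : nat) : positive_jumps z -> positive_jumps w -> (0 < n)%N ->
  leaves z w n = leaves z w (n%:Z - (z n)%:Z) ++ leaves z w (n%:Z - (w n)%:Z).
Proof.
move=> zp wp; case: n => // n _; rewrite /leaves absz_nat /=.
have z0 := zp n.+1 isT; have w0 := wp n.+1 isT.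
rewrite filter_cat; congr (_ ++ _); congr seq.filter; apply: Tfuel_stable => //; lia.
Qed.

Lemma landing_le0 z (m : int) : m <= 0 -> landing z m = m.
Proof. by rewrite /landing; case: `|m|%N => //= k ->. Qed.

Lemma landing_gt0 z (n : nat) : positive_jumps z -> (0 < n)%N ->
  landing z n = landing z (n%:Z - (z n)%:Z).
Proof.
move=> zp; case: n => // n _; rewrite {1}/landing absz_nat /=.
have z0 := zp n.+1 isT; apply: landing_fuel_stable => //; lia.
Qed.

Lemma leaves_agree z w z' w' (n : nat) (m : int) : m <= n%:Z ->
  agree n z z' -> agree n w w' -> leaves z w m = leaves z' w' m.
Proof.
move=> mn zz ww; rewrite /leaves; congr seq.filter.
move: `|m|%N => f; elim: f m mn => //= f IH m mn; case: ifPn => // m0.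
by rewrite zz ?ww ?IH //; lia.
Qed.

Lemma landing_agree z z' (n : nat) (m : int) : m <= n%:Z ->
  agree n z z' -> landing z m = landing z' m.
Proof.
move=> mn zz; rewrite /landing.
move: `|m|%N => f; elim: f m mn => //= f IH m mn; case: ifPn => // m0.
by rewrite zz ?IH //; lia.
Qed.

Lemma landing_in_leaves z w (m : int) : positive_jumps z -> positive_jumps w ->
  landing z m \in leaves z w m.
Proof.
move=> zp wp; have [k] := ubnP `|m|%N; elim: k m => // k IH m mk.
have [m0|m0] := leP m 0; first by rewrite landing_le0 // leaves_le0 // inE.
case: m m0 mk => // n n0 nk; have z0 := zp n n0.
rewrite landing_gt0 // leaves_gt0 // mem_cat.
have [m0|m0] := leP (n%:Z - (z n)%:Z) 0; last by rewrite IH //; lia.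
by rewrite landing_le0 // leaves_le0 // inE eqxx.
Qed.

Lemma Lambda_nleaves (T : Type) (Z W : nat -> T -> nat) n x :
  Lambda Z W n x = nleaves (Z ^~ x) (W ^~ x) n [:: 0%N].
Proof.
rewrite /Lambda /Lset /Tset /nleaves /= cats0 subr0 filter_undup.
by rewrite /leaves absz_nat.
Qed.

Lemma le_size_undup (T : eqType) (s t : seq T) :
  {subset s <= t} -> (size (undup s) <= size (undup t))%N.
Proof.
move=> st; apply: uniq_leq_size; first exact: undup_uniq.
by move=> x; rewrite !mem_undup; exact: st.
Qed.

Lemma nleaves_sub z w n C C' : {subset C <= C'} -> (nleaves z w n C <= nleaves z w n C')%N.
Proof.
move=> CC; apply: le_size_undup => v /flatten_mapP[c cC vc].
by apply/flatten_mapP; exists c => //; exact: CC.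
Qed.

(** All starting points are at most [k] and the recursion only goes down, so no jump at an index
    above [k] is read. *)
Lemma nleaves_agree z w z' w' n k C : {in C, forall c, (n <= k + c)%N} ->
  agree k z z' -> agree k w w' -> nleaves z w n C = nleaves z' w' n C.
Proof.
move=> Ck zz ww; rewrite /nleaves; congr (size (undup (flatten _))).
by apply/eq_in_map => c /Ck cn; apply: (@leaves_agree _ _ _ _ k) => //; lia.
Qed.

Lemma nleaves_split z w n C : positive_jumps z -> positive_jumps w -> (0 < n)%N ->
  nleaves z w n (0%N :: C) = nleaves z w n [:: z n, w n & C].
Proof. by move=> zp wp n0; rewrite /nleaves /= subr0 leaves_gt0 // catA. Qed.

Lemma nleaves_shift z w n a C : (a <= n)%N ->
  nleaves z w n [seq (a + c)%N | c <- C] = nleaves z w (n - a)%N C.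
Proof.
move=> an; rewrite /nleaves -map_comp; congr (size (undup (flatten _))).
by apply: eq_map => c /=; congr leaves; lia.
Qed.

Lemma nleaves_uniq_landing z w n C : positive_jumps z -> positive_jumps w ->
  uniq [seq landing z (n%:Z - c%:Z) | c <- C] -> (size C <= nleaves z w n C)%N.
Proof.
move=> zp wp u; rewrite -(size_map (fun c : nat => landing z (n%:Z - c%:Z))).
apply: uniq_leq_size => // v /mapP[c cC ->]; rewrite mem_undup.
by apply/flatten_mapP; exists c => //; exact: landing_in_leaves.
Qed.

(** Bookkeeping for [ultimately_few_spread]: the child at distance [a] becomes the new origin, and
    the margin [m + a] pays for the translation. *)
Lemma spread_cons a b m D C : all (fun c => m + a < c)%N C ->
  pairwise (fun x y => y + D <= x)%N C -> (m + a < b)%N ->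
  (forall c, c \in C -> (c + D <= b)%N) ->
  let C' := [seq (c - a)%N | c <- b :: C] in
  [/\ all (fun c => m < c)%N C', pairwise (fun x y => y + D <= x)%N C' &
      b :: C = [seq (a + c)%N | c <- C']].
Proof.
move=> mC pC mb bC /=.
have sub x c : (m + a < c -> c + D <= x -> c - a + D <= x - a)%N by lia.
split.
- rewrite all_map; apply/andP; split; first by lia.
  by apply: sub_all mC => c /=; lia.
- rewrite all_map pairwise_map; apply/andP; split.
    by apply/allP => c cC; apply: sub; [exact: (allP mC)|exact: bC].
  apply: (sub_in_pairwise (P := fun c => m + a < c)%N) pC => // x y _ my; exact: sub.
- congr (_ :: _); first by lia.
  rewrite -map_comp -[LHS]map_id; apply/eq_in_map => c /(allP mC) /=; lia.
Qed.


(** * The renewal sequence [r_n] and its correlations *)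

Lemma size_rlist (R : realType) (q : nat -> R) n : size (rlist q n) = n.+1.
Proof. by elim: n => //= n IH; rewrite size_rcons IH. Qed.

Lemma nth_rlist (R : realType) (q : nat -> R) n m : (m <= n)%N ->
  nth 0 (rlist q n) m = rseq q m.
Proof.
elim: n => [|n IH]; first by rewrite leqn0 => /eqP->.
rewrite leq_eqVlt => /predU1P[->//|mn].
by rewrite [rlist _ _]/= nth_rcons size_rlist mn IH.
Qed.

Lemma rseq0 (R : realType) (q : nat -> R) : rseq q 0 = 1. Proof. by []. Qed.

Lemma rseqS (R : realType) (q : nat -> R) n :
  rseq q n.+1 = \sum_(1 <= i < n.+2) q i * rseq q (n.+1 - i).
Proof.
rewrite {1}/rseq /= nth_rcons size_rlist ltnn eqxx.
by apply: eq_big_nat => i /andP[i0 i1]; rewrite nth_rlist //; lia.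
Qed.

Lemma rseq_ge0 (R : realType) (q : nat -> R) n : (forall i, 0 <= q i) -> 0 <= rseq q n.
Proof.
move=> q0; have [k] := ubnP n; elim: k n => // k IH [|n] nk; first exact: ler01.
rewrite rseqS big_nat sumr_ge0 // => i i1; apply: mulr_ge0 => //; apply: IH; lia.
Qed.

(** With points coded by their distance to [n], the probability that a renewal chain started at [x]
    visits [j]. *)
Definition rshift {R : realType} (q : nat -> R) (x j : nat) : R :=
  if (x <= j)%N then rseq q (j - x) else 0.

(** Expected number of common points, with code below [J], of two independent renewal chains started
    at [x] and [y]. *)
Definition rcorr {R : realType} (q : nat -> R) (J x y : nat) : R :=
  \sum_(j < J) rshift q x j * rshift q y j.

Lemma rshift_ge0 (R : realType) (q : nat -> R) x j : (forall i, 0 <= q i) -> 0 <= rshift q x j.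
Proof. by move=> q0; rewrite /rshift; case: ifP => // _; exact: rseq_ge0. Qed.

Lemma rcorrC (R : realType) (q : nat -> R) J x y : rcorr q J x y = rcorr q J y x.
Proof. by apply: eq_bigr => j _; rewrite mulrC. Qed.

Lemma rcorr_ge0 (R : realType) (q : nat -> R) J x y :
  (forall i, 0 <= q i) -> 0 <= rcorr q J x y.
Proof. by move=> q0; apply: sumr_ge0 => j _; rewrite mulr_ge0 ?rshift_ge0. Qed.

(** The common starting point alone counts 1; hence [rcorr] dominates any probability once two
    chains have met. *)
Lemma rcorr_diag (R : realType) (q : nat -> R) J x : (forall i, 0 <= q i) -> (x < J)%N ->
  1 <= rcorr q J x x.
Proof.
move=> q0 xJ; rewrite /rcorr (bigD1 (Ordinal xJ)) //= /rshift leqnn subnn rseq0 mulr1.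
by rewrite lerDl sumr_ge0 // => j _; rewrite mulr_ge0 // -/(rshift q x j) rshift_ge0.
Qed.

(** The renewal equation for [r_(j - x)], truncated: jumps longer than [j - x] overshoot and
    contribute 0, and stopping before [A] only drops nonnegative terms. *)
Lemma rshift_renewal (R : realType) (q : nat -> R) A x j : (forall i, 0 <= q i) -> j != x ->
  \sum_(1 <= i < A) q i * rshift q (x + i) j <= rshift q x j.
Proof.
move=> q0 jx; rewrite {2}/rshift; case: leqP => xj; last first.
  rewrite big_nat big1 // => i _; rewrite /rshift ifF ?mulr0 //; lia.
case E : (j - x)%N => [|n]; first by lia.
rewrite rseqS big_mkcond [leRHS]big_mkcond /=.
pose F i := if (i < A)%N && (i < n.+2)%N then q i * rshift q (x + i) j else 0.
have e i : (0 < i)%N -> (i < n.+2)%N -> rshift q (x + i) j = rseq q (n.+1 - i).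
  by move=> i0 i1; rewrite /rshift ifT ?subnDA ?E //; lia.
have z i : (n.+2 <= i)%N -> rshift q (x + i) j = 0.
  by move=> i1; rewrite /rshift ifF //; lia.
case: (leqP A n.+2) => An.
  case: (posnP A) => A0.
    rewrite A0 big_geq //; apply: sumr_ge0 => i _; rewrite mulr_ge0 ?rseq_ge0 //.
  rewrite [leRHS](@big_cat_nat _ _ _ A) //=.
  rewrite -[leLHS]addr0 lerD //; last by apply: sumr_ge0 => i _; rewrite mulr_ge0 ?rseq_ge0.
  by rewrite le_eqVlt; apply/orP; left; apply/eqP/eq_big_nat => i ?; rewrite e //; lia.
rewrite (@big_cat_nat _ _ _ n.+2) //=; last lia.
rewrite [X in _ + X <= _]big_nat [X in _ + X <= _]big1 ?addr0; last first.
  by move=> i ?; rewrite z ?mulr0 //; lia.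
by rewrite le_eqVlt; apply/orP; left; apply/eqP/eq_big_nat => i ?; rewrite e //; lia.
Qed.

(** Superharmonicity of [rcorr] when the higher point, the one with the smaller code, jumps;
    [meet_bound] runs on this recursion. *)
Lemma rcorr_renewal (R : realType) (q : nat -> R) A J x y :
  (forall i, 0 <= q i) -> (x < y)%N ->
  \sum_(1 <= i < A) q i * rcorr q J (x + i) y <= rcorr q J x y.
Proof.
move=> q0 xy; rewrite /rcorr.
under eq_bigr do rewrite mulr_sumr.
rewrite exchange_big /=; apply: ler_sum => j _.
under eq_bigr do rewrite mulrA.
rewrite -mulr_suml; have [e|jx] := eqVneq (j : nat) x.
  (* At [j = x] both sides vanish: the chain from [y > x] never visits [x]. *)
  by rewrite {2 4}/rshift ifF ?mulr0 //; lia.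
by rewrite ler_wpM2r ?rshift_ge0 // rshift_renewal.
Qed.

(** Only [j >= y] contributes, and there [j - x >= D]: one factor runs over a tail of the
    square-summable sequence, the other is controlled by [S]. *)
Lemma rcorr_far (R : realType) (q : nat -> R) (S e : R) D J x y :
  0 < e -> (x + D <= y)%N ->
  (forall n, \sum_(i < n) rseq q i ^+ 2 <= S) ->
  (forall n, \sum_(D <= i < n) rseq q i ^+ 2 <= e ^+ 2) ->
  rcorr q J x y <= e * (S + 1) / 2.
Proof.
move=> e0 xy hS hD.
have shE k : (k <= J)%N -> \sum_(k <= j < J) rseq q (j - k) ^+ 2 <= S.
  by move=> kJ; rewrite -{1}[k]add0n big_addn;
    under eq_bigr do rewrite addnK; rewrite big_mkord.
have S0 : 0 <= S by have := hS 0%N; rewrite big_ord0.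
have [yJ|Jy] := leqP y J; last first.
  rewrite /rcorr big1 => [|j _]; last first.
    by rewrite {2}/rshift ifF ?mulr0 //; have := ltn_ord j; lia.
  by rewrite divr_ge0 // mulr_ge0 ?(ltW e0) // addr_ge0.
have -> : rcorr q J x y = \sum_(y <= j < J) rseq q (j - x) * rseq q (j - y).
  rewrite /rcorr -(big_mkord xpredT (fun j => rshift q x j * rshift q y j)).
  rewrite (@big_cat_nat _ _ _ y) //= big_nat big1 ?add0r; last first.
    by move=> j ?; rewrite {2}/rshift ifF ?mulr0 //; lia.
  by apply: eq_big_nat => j ?; rewrite /rshift !ifT //; lia.
have h1 : \sum_(y <= j < J) rseq q (j - x) ^+ 2 <= e ^+ 2.
  have xJ : (x <= y)%N by lia.
  have -> : \sum_(y <= j < J) rseq q (j - x) ^+ 2 =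
    \sum_(y - x <= i < J - x) rseq q i ^+ 2.
    rewrite -{1}(subnK xJ) big_addn; apply: eq_bigr => i _; by rewrite addnK.
  apply: le_trans (hD (J - x)%N).
  have [yJ'|?] := leqP (y - x) (J - x); last first.
    by rewrite big_geq ?sumr_ge0 // => *; rewrite ?sqr_ge0 //; lia.
  rewrite [leRHS](@big_cat_nat _ _ _ (y - x)) //=; last lia.
  by rewrite lerDr sumr_ge0 // => i _; rewrite sqr_ge0.
(* AM-GM: [2 a b <= a^2 / e + e b^2] *)
apply: (@le_trans _ _ (\sum_(y <= j < J)
  (e^-1 / 2 * rseq q (j - x) ^+ 2 + e / 2 * rseq q (j - y) ^+ 2))).
  apply: ler_sum => j _; set a := rseq _ _; set b := rseq _ _.
  have -> : e^-1 / 2 * a ^+ 2 + e / 2 * b ^+ 2 = a * b + (a - e * b) ^+ 2 * (e^-1 / 2).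
    by field; rewrite gt_eqF.
  by rewrite lerDl mulr_ge0 ?sqr_ge0 // divr_ge0 // invr_ge0 ltW.
rewrite big_split /= -!mulr_sumr.
apply: (@le_trans _ _ (e^-1 / 2 * e ^+ 2 + e / 2 * S)).
  apply: lerD; apply: ler_wpM2l; rewrite ?divr_ge0 ?invr_ge0 ?(ltW e0) //; exact: shE.
by rewrite le_eqVlt; apply/orP; left; apply/eqP; field; rewrite gt_eqF.
Qed.

(** * Events given by a variable with countably many values *)

Section CountableRange.
Context {d : measure_display} {T : measurableType d} {R : realType}.
Variables (P : probability T R) (C : countType) (f : T -> C).
Hypothesis fm : forall c, measurable [set x | f x = c].

(** The [pickle] code cuts the preimage of an arbitrary [B] into a disjoint sequence of fibres, some
    of them empty. *)
Let slice (B : set C) (k : nat) := [set x | B (f x) /\ pickle (f x) = k].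

Let sliceE B : f @^-1` B = \bigcup_k slice B k.
Proof. by apply/seteqP; split=> [x Bx|x [k _ [Bx _]] //]; exists (pickle (f x)). Qed.

Let slice_cases B k : slice B k = set0 \/ exists c, slice B k = [set x | f x = c].
Proof.
have [[c [Bc ck]]|nc] := pselect (exists c, B c /\ pickle c = k).
  right; exists c; apply/seteqP; split=> x /=; last by rewrite /slice /= => ->.
  by move=> [_ kx]; apply: (pcan_inj (@pickleK C)); rewrite kx ck.
left; apply/seteqP; split=> x //= [Bx kx]; apply: nc; by exists (f x).
Qed.

Let slice_measurable B k : measurable (slice B k).
Proof. by case: (slice_cases B k) => [->|[c ->]]; [exact: measurable0|exact: fm]. Qed.

Lemma measurable_countable_preimage (B : set C) : measurable (f @^-1` B).
Proof. by rewrite sliceE; apply: bigcup_measurable => k _; exact: slice_measurable. Qed.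

(** Countable additivity turns both sides into series over the slices, which agree term by term. *)
Lemma indep_countable_preimage (E : set T) (B : set C) : measurable E ->
  (forall c, P ([set x | f x = c] `&` E) = (P [set x | f x = c] * P E)%E) ->
  P (f @^-1` B `&` E) = (P (f @^-1` B) * P E)%E.
Proof.
move=> mE ind; rewrite sliceE setI_bigcupl.
have dis : trivIset setT (slice B).
  by move=> i j _ _ [x [[_ <-] [_ <-]]].
have mI k : measurable (slice B k `&` E).
  by apply: measurableI => //; exact: slice_measurable.
rewrite (measure_semi_bigcup _ mI (@trivIset_setIr _ _ _ _ (fun=> E) dis)); last first.
  exact: bigcup_measurable.
rewrite (measure_semi_bigcup _ (slice_measurable B) dis); last first.
  by apply: bigcup_measurable => k _; exact: slice_measurable.
have -> : P E = (fine (P E))%:E by rewrite fineK // fin_num_measure.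
rewrite muleC -nneseriesZl; last by move=> i _; exact: measure_ge0.
apply: eq_eseriesr => k _; rewrite fineK ?fin_num_measure // muleC.
case: (slice_cases B k) => [->|[c ->]]; last by exact: ind.
by rewrite set0I measure0 mul0e.
Qed.

End CountableRange.

(** * Independence of the jumps at one index from those at lower indices *)

Section Jumps.
Context {d : measure_display} {T : measurableType d} {R : realType}.
Variables (P : probability T R) (Z W : nat -> T -> nat).
Hypothesis Zmeas : forall n (k : nat), measurable [set x | Z n x = k].
Hypothesis Wmeas : forall n (k : nat), measurable [set x | W n x = k].
Hypothesis Zpos : forall n x, (0 < n)%N -> (0 < Z n x)%N.
Hypothesis Wpos : forall n x, (0 < n)%N -> (0 < W n x)%N.
Hypothesis indep : mutually_independent P (ZWfam Z W).
Hypothesis iid : identically_distributed P (ZWfam Z W).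

Local Notation q := (qlaw P (Z 1%N)).
Local Notation X := (ZWfam Z W).

(** The event is decided by the jumps at indices [1] to [n]. No sigma-algebra is generated: the
    jumps are discrete, so measurability follows. *)
Definition adapted (n : nat) (E : set T) := forall x x',
  agree n (Z ^~ x) (Z ^~ x') -> agree n (W ^~ x) (W ^~ x') -> E x -> E x'.

Let ZX n : Z n.+1 = X n.*2.
Proof. by rewrite /ZWfam odd_double doubleK. Qed.

Let WX n : W n.+1 = X n.*2.+1.
Proof. by rewrite /ZWfam /= odd_double /= uphalf_double. Qed.

Let Xmeas i k : measurable [set x | X i x = k].
Proof. by rewrite /ZWfam; case: odd. Qed.

(** The jumps [Z_1, W_1, ..., Z_n, W_n] as one variable with values in the countable type
    [seq nat]. *)
Let vec n x := [seq X i x | i <- iota 0 n.*2].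

Let vec_fiber n s : size s = n.*2 ->
  [set x | vec n x = s] = \big[setI/setT]_(i <- iota 0 n.*2) (X i @^-1` [set nth 0%N s i]).
Proof.
move=> ss; rewrite -bigcap_seq; apply/seteqP; split=> x /=.
  move=> <- i /=; rewrite mem_iota => /andP[_ i2].
  by rewrite (nth_map 0%N) ?size_iota // nth_iota.
move=> h; apply: (@eq_from_nth _ 0%N) => [|i]; rewrite size_map size_iota //.
move=> i2; rewrite (nth_map 0%N) ?size_iota // nth_iota // add0n.
by apply: h => /=; rewrite mem_iota.
Qed.

Let vec_fiber0 n s : size s != n.*2 -> [set x | vec n x = s] = set0.
Proof.
move=> ss; apply/seteqP; split=> x //= e; move: ss.
by rewrite -e size_map size_iota eqxx.
Qed.

Let vec_meas n s : measurable [set x | vec n x = s].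
Proof.
have [e|ne] := eqVneq (size s) n.*2; last by rewrite vec_fiber0 //; exact: measurable0.
by rewrite vec_fiber //; apply: bigsetI_measurable => i _;
  exact: measurable_countable_preimage.
Qed.

Let adaptedE n E : adapted n E -> E = vec n @^-1` [set s | exists2 x, E x & vec n x = s].
Proof.
move=> aE; apply/seteqP; split=> [x Ex|x [y Ey /eq_in_map e]] /=; first by exists x.
apply: (aE y) => // k /andP[]; case: k => // k _ kn.
  by rewrite ZX; apply: e; rewrite mem_iota; lia.
by rewrite WX; apply: e; rewrite mem_iota; lia.
Qed.

Lemma adapted_measurable n E : adapted n E -> measurable E.
Proof. by move=> /adaptedE ->; apply: measurable_countable_preimage; exact: vec_meas. Qed.

Lemma Z_preimage_measurable n (A : set nat) : measurable (Z n @^-1` A).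
Proof. by apply: measurable_countable_preimage; exact: Zmeas. Qed.

Lemma W_preimage_measurable n (A : set nat) : measurable (W n @^-1` A).
Proof. by apply: measurable_countable_preimage; exact: Wmeas. Qed.

Let ZW_indep n (A B : set nat) :
  P (Z n.+1 @^-1` A `&` W n.+1 @^-1` B) = (P (Z n.+1 @^-1` A) * P (W n.+1 @^-1` B))%E.
Proof.
have u : uniq [:: n.*2; n.*2.+1] by rewrite /= inE neq_ltn ltnSn.
have := @indep _ (fun i => if i == n.*2 then A else B) u.
rewrite !big_cons !big_nil setIT mule1 eqxx ifF; last by lia.
by rewrite -ZX -WX.
Qed.

(** By [indep_countable_preimage] it is enough to treat the fibres of [vec], which are cylinders. *)
Lemma adapted_indep n E (A B : set nat) : adapted n E ->
  P (E `&` (Z n.+1 @^-1` A `&` W n.+1 @^-1` B)) =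
  (P E * (P (Z n.+1 @^-1` A) * P (W n.+1 @^-1` B)))%E.
Proof.
move=> /adaptedE ->; rewrite -ZW_indep; apply: indep_countable_preimage.
- exact: vec_meas.
- by apply: measurableI; [exact: Z_preimage_measurable|exact: W_preimage_measurable].
move=> s; have [e|ne] := eqVneq (size s) n.*2; last first.
  by rewrite vec_fiber0 // set0I measure0 mul0e.
rewrite ZW_indep vec_fiber //.
(* One family prescribing [s] on the first [2n] variables and [A], [B] on the next two, so that
   mutual independence applies to all of them at once. *)
pose H i := if i == n.*2 then A else if i == n.*2.+1 then B else [set nth 0%N s i].
have H1 i : i \in iota 0 n.*2 -> H i = [set nth 0%N s i].
  by rewrite mem_iota /H => ?; rewrite !ifF //; lia.
have Ha : H n.*2 = A by rewrite /H eqxx.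
have Hb : H n.*2.+1 = B by rewrite /H ifF ?eqxx //; lia.
have u : uniq (iota 0 n.*2 ++ [:: n.*2; n.*2.+1]).
  rewrite cat_uniq iota_uniq /= !mem_iota !inE /=; lia.
have := @indep _ H u.
rewrite !big_cat /= !big_cons !big_nil setIT mule1 Ha Hb -ZX -WX.
rewrite [X in P (X `&` _)](_ : _ =
  \big[setI/setT]_(i <- iota 0 n.*2) (X i @^-1` [set nth 0%N s i])); last first.
  by apply: eq_big_seq => i /H1 ->.
move=> ->; congr (_ * _)%E.
have := @indep _ (fun i => [set nth 0%N s i]) (iota_uniq 0 n.*2) => ->.
by apply: eq_big_seq => i /H1 ->.
Qed.

(** * Real-valued probabilities and the law of one jump *)

Local Notation pr E := (fine (P E)).

Let pr_fin (E : set T) : measurable E -> P E = (pr E)%:E.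
Proof. by move=> mE; rewrite fineK // fin_num_measure. Qed.

Lemma pr_ge0 (E : set T) : 0 <= pr E.
Proof. by apply: fine_ge0; exact: measure_ge0. Qed.

Lemma pr_le (E F : set T) : measurable E -> measurable F -> E `<=` F -> pr E <= pr F.
Proof.
by move=> mE mF EF; rewrite -lee_fin -!pr_fin //; apply: le_measure; rewrite ?inE.
Qed.

Lemma pr_le1 (E : set T) : measurable E -> pr E <= 1.
Proof. by move=> mE; rewrite -lee_fin -pr_fin //; exact: probability_le1. Qed.

Lemma pr_setU (E F : set T) : measurable E -> measurable F ->
  pr (E `|` F) <= pr E + pr F.
Proof.
move=> mE mF; rewrite -lee_fin EFinD -!pr_fin //; last exact: measurableU.
exact: measureU2.
Qed.

Lemma pr_bigsetU (I : eqType) (s : seq I) (E : I -> set T) :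
  (forall i, i \in s -> measurable (E i)) ->
  pr (\big[setU/set0]_(i <- s) E i) <= \sum_(i <- s) pr (E i).
Proof.
elim: s => [|i s IH] mE; first by rewrite !big_nil measure0.
have mi : measurable (E i) by apply: mE; rewrite mem_head.
have ms j : j \in s -> measurable (E j) by move=> js; apply: mE; rewrite inE js orbT.
rewrite !big_cons; apply: le_trans (pr_setU mi _) _.
  by rewrite big_seq; apply: bigsetU_measurable.
by rewrite lerD2l IH.
Qed.

Let lawE i k : P [set x | X i x = k] = (q k)%:E.
Proof. by rewrite (iid i 0) /qlaw pr_fin. Qed.

Lemma Z_law n k : P (Z n.+1 @^-1` [set k]) = (q k)%:E.
Proof. by rewrite ZX -(lawE n.*2). Qed.

Lemma W_law n k : P (W n.+1 @^-1` [set k]) = (q k)%:E.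
Proof. by rewrite WX -(lawE n.*2.+1). Qed.

Lemma qlaw_ge0 k : 0 <= q k.
Proof. exact: pr_ge0. Qed.

Lemma qlaw0 : q 0 = 0.
Proof.
rewrite /qlaw (_ : [set x | _] = set0) ?measure0 //.
by apply/seteqP; split=> x //= zx; have := Zpos x (ltn0Sn 0); rewrite zx.
Qed.

Let Zle n A : pr (Z n.+1 @^-1` [set k | (k <= A)%N]) = \sum_(1 <= k < A.+1) q k.
Proof.
elim: A => [|A IH].
  rewrite big_geq // (_ : _ @^-1` _ = Z n.+1 @^-1` [set 0%N]).
    by rewrite Z_law /= qlaw0.
  by apply/seteqP; split=> x /=; rewrite leqn0 => /eqP.
rewrite big_nat_recr //= -IH.
rewrite (_ : _ @^-1` _ = Z n.+1 @^-1` [set k | (k <= A)%N] `|` Z n.+1 @^-1` [set A.+1]).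
  have m := Z_preimage_measurable n.+1 [set k | (k <= A)%N].
  have m' := Z_preimage_measurable n.+1 [set A.+1].
  have e : pr (Z n.+1 @^-1` [set A.+1]) = q A.+1 by rewrite Z_law.
  rewrite measureU //; first by rewrite fineD ?fin_num_measure // e.
  by apply/seteqP; split=> x //= -[] /[swap] ->; rewrite ltnn.
apply/seteqP; split=> x /=; first by rewrite leq_eqVlt => /predU1P[->|]; [right|left].
by case=> [|->] //; exact: leqW.
Qed.

Definition tail (A : nat) : R := 1 - \sum_(1 <= k < A.+1) q k.

Lemma Z_tail n A : pr (Z n.+1 @^-1` [set k | (A < k)%N]) = tail A.
Proof.
rewrite /tail -(Zle n) (_ : _ @^-1` _ = ~` (Z n.+1 @^-1` [set k | (k <= A)%N])).
  have m := Z_preimage_measurable n.+1 [set k | (k <= A)%N].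
  by rewrite probability_setC // fineB ?fin_num_measure.
by apply/seteqP; split=> x /=; rewrite ltnNge => /negP.
Qed.

Lemma tail_ge0 A : 0 <= tail A.
Proof. by rewrite -(Z_tail 0); exact: pr_ge0. Qed.

(** Continuity from below: the events [Z_1 <= n] exhaust the space. *)
Lemma tail_small (e : R) : 0 < e -> exists A0, forall A, (A0 <= A)%N -> tail A <= e.
Proof.
move=> e0.
have : (P \o (fun n => Z 1 @^-1` [set k | (k <= n)%N])) @ \oo -->
    P (\bigcup_n Z 1 @^-1` [set k | (k <= n)%N]).
  apply: nondecreasing_cvg_mu.
  - by move=> i; exact: Z_preimage_measurable.
  - by apply: bigcup_measurable => i _; exact: Z_preimage_measurable.
  - by move=> m n mn; apply/subsetPset => x /= h; exact: leq_trans mn.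
rewrite (_ : \bigcup_n _ = setT); last first.
  by apply/seteqP; split=> x //= _; exists (Z 1 x) => /=.
rewrite probability_setT => /fine_cvgP[_].
move=> /cvgrPdist_le /(_ _ e0) [N _ hN]; exists N => A NA.
have := hN A NA; rewrite /= Zle /tail. move=> h. by apply: le_trans h; exact: ler_norm.
Qed.

Lemma Z_step n E k : adapted n E -> pr (E `&` Z n.+1 @^-1` [set k]) = pr E * q k.
Proof.
move=> aE; have mE := adapted_measurable aE.
have := adapted_indep [set k] setT aE.
rewrite preimage_setT setIT probability_setT mule1 Z_law => ->.
by rewrite fineM // fin_num_measure.
Qed.

Lemma ZW_step n E k l : adapted n E ->
  pr (E `&` (Z n.+1 @^-1` [set k] `&` W n.+1 @^-1` [set l])) = pr E * (q k * q l).
Proof.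
move=> aE; have mE := adapted_measurable aE.
by rewrite adapted_indep // Z_law W_law -EFinM fineM // fin_num_measure.
Qed.

(** Cutting the jump at [A] makes the union over its values finite, at the price of [tail A]. *)
Lemma jump_cover n A E (H : nat -> set T) : measurable E ->
  (forall k, (0 < k)%N -> measurable (H k)) ->
  (forall x, E x -> H (Z n.+1 x) x) ->
  pr E <= tail A + \sum_(1 <= k < A.+1) pr (H k).
Proof.
move=> mE mH EH; rewrite -(Z_tail n).
have mH' i : i \in index_iota 1 A.+1 -> measurable (H i).
  by rewrite mem_index_iota => /andP[? _]; exact: mH.
have mU : measurable (\big[setU/set0]_(1 <= k < A.+1) H k).
  by rewrite big_seq; apply: bigsetU_measurable.
apply: le_trans (_ : pr (Z n.+1 @^-1` [set k | (A < k)%N] `|`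
  \big[setU/set0]_(1 <= k < A.+1) H k) <= _); last first.
  apply: le_trans (pr_setU (Z_preimage_measurable _ _) mU) _.
  by rewrite lerD2l; exact: pr_bigsetU.
apply: pr_le => //; first by apply: measurableU => //; exact: Z_preimage_measurable.
move=> x Ex; have [zA|Az] := leqP (Z n.+1 x) A; last by left.
right; rewrite -bigcup_seq; exists (Z n.+1 x); last exact: EH.
by rewrite /= mem_index_iota ltnS zA Zpos.
Qed.

Let Zp x : positive_jumps (Z ^~ x).
Proof. by move=> k; exact: Zpos. Qed.

Let Wp x : positive_jumps (W ^~ x).
Proof. by move=> k; exact: Wpos. Qed.

Lemma qlaw_sum_le1 A : \sum_(1 <= k < A.+1) q k <= 1.
Proof. by have := tail_ge0 A; rewrite /tail subr_ge0. Qed.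

Lemma qlaw_le1 k : q k <= 1.
Proof. exact: pr_le1. Qed.

(** * Two Z-chains ending at the same leaf *)

Definition meet (n x y : nat) := [set t |
  landing (Z ^~ t) (n%:Z - x%:Z) = landing (Z ^~ t) (n%:Z - y%:Z)].

Let meet_adapted n k x y : (n <= k + x)%N -> (n <= k + y)%N -> adapted k (meet n x y).
Proof.
move=> kx ky t t' Ztt' _; rewrite /meet /=.
by rewrite !(@landing_agree (Z ^~ t) (Z ^~ t') k) //; lia.
Qed.

Lemma meet_measurable n x y : measurable (meet n x y).
Proof. by apply: (@adapted_measurable n); apply: meet_adapted; exact: leq_addr. Qed.

Lemma meetC n x y : meet n x y = meet n y x.
Proof. by apply/seteqP; split=> t; exact: esym. Qed.

(** Induction on the total height. The higher point jumps, at an index above all those still to be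
    read, so this jump is independent of the rest. [rcorr] satisfies the same recursion as an
    inequality and is at least 1 once the points coincide; each jump costs one [tail A]. The
    condition [n + A < J] keeps the codes below [J]. *)
Lemma meet_bound n A J x y : (n + A < J)%N -> (x < J)%N -> (y < J)%N ->
  pr (meet n x y) <= (n - x + (n - y))%:R * tail A + rcorr q J x y.
Proof.
move=> nJ; have [k] := ubnP (n - x + (n - y)); elim: k x y => // k IH x y kxy xJ yJ.
have q0 := qlaw_ge0; have t0 := tail_ge0 A.
have [->|nxy] := eqVneq x y.
  apply: le_trans (pr_le1 (meet_measurable _ _ _)) _.
  apply: le_trans (rcorr_diag q0 yJ) _.
  by rewrite lerDr mulr_ge0.
wlog xy : x y kxy xJ yJ nxy / (x < y)%N.
  move=> h; have [xy|yx] := ltnP x y; first exact: h.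
  rewrite meetC rcorrC addnC; apply: h => //; lia.
(* If [n <= x < y], both points are already leaves, and distinct. *)
have [nx|xn] := leqP n x.
  rewrite (_ : meet n x y = set0).
    by rewrite measure0 addr_ge0 ?rcorr_ge0 // mulr_ge0.
  apply/seteqP; split=> t //; rewrite /meet /= !landing_le0; lia.
case E : (n - x)%N => [|m]; first by lia.
have e0 : n%:Z - x%:Z = m.+1%:Z by lia.
have aH i : (0 < i)%N -> adapted m (meet n (x + i) y).
  by move=> i0; apply: meet_adapted; lia.
pose H i := meet n (x + i) y `&` Z m.+1 @^-1` [set i].
have mH i : (0 < i)%N -> measurable (H i).
  by move=> i0; apply: measurableI; [exact: meet_measurable|exact: Z_preimage_measurable].
have EH t : meet n x y t -> H (Z m.+1 t) t.
  rewrite /H /meet /= e0 landing_gt0 // => <-; split => //; congr landing; lia.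
apply: le_trans (jump_cover A (meet_measurable n x y) mH EH) _.
set c : R := (m + (n - y))%:R.
have -> : (m.+1 + (n - y))%:R * tail A = tail A + c * tail A.
  by rewrite addSn -natr1 mulrDl mul1r addrC.
rewrite -[leRHS]addrA lerD2l.
(* Induction hypothesis at [x + i]; its tail terms sum to at most [c * tail A]. *)
apply: (@le_trans _ _ (\sum_(1 <= i < A.+1) (c * tail A * q i + q i * rcorr q J (x + i) y))).
  rewrite big_nat [leRHS]big_nat; apply: ler_sum => i /andP[i0 iA].
  rewrite /H (Z_step _ (aH _ i0)) [q i * _]mulrC -mulrDl ler_wpM2r //.
  apply: le_trans (IH (x + i)%N y _ _ _) _; rewrite ?lerD2r ?ler_wpM2r ?ler_nat //; lia.
rewrite big_split /= lerD ?rcorr_renewal // -mulr_sumr.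
by rewrite ler_piMr ?qlaw_sum_le1 // mulr_ge0.
Qed.

Lemma meet_far n x y (g : R) : (forall J, rcorr q J x y <= g) -> pr (meet n x y) <= g.
Proof.
move=> hg; apply/ler_addgt0Pr => e e0.
pose c : R := (n - x + (n - y)).+1%:R; have c0 : 0 < c by rewrite ltr0Sn.
(* The truncation errors of all jumps then add up to at most [e]. As [J] grows with [A], the bound
   [g] has to be uniform in [J]. *)
have [A0 hA] := tail_small (divr_gt0 e0 c0).
pose A := (A0 + x + y)%N.
apply: le_trans (@meet_bound n A (n + A).+1 x y _ _ _) _; rewrite /A; try lia.
rewrite addrC lerD ?hg //.
apply: (@le_trans _ _ (c * (e / c))); last by rewrite mulrC divfK ?gt_eqF.
by rewrite ler_pM ?tail_ge0 ?ler_nat // hA //; lia.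
Qed.

(** * The probability of few leaves *)

Definition few_leaves (K n : nat) (C : seq nat) :=
  [set x | (nleaves (Z ^~ x) (W ^~ x) n C <= K)%N].

Let few_adapted K n k C : {in C, forall c, (n <= k + c)%N} -> adapted k (few_leaves K n C).
Proof. by move=> Ck t t' zz ww; rewrite /few_leaves /= (nleaves_agree Ck zz ww). Qed.

Lemma few_measurable K n C : measurable (few_leaves K n C).
Proof. by apply: (@adapted_measurable n); apply: few_adapted => c _; exact: leq_addr. Qed.

Lemma few_sub K n C C' : {subset C <= C'} -> pr (few_leaves K n C') <= pr (few_leaves K n C).
Proof.
move=> CC; apply: pr_le; [exact: few_measurable..|].
by move=> t; exact: leq_trans (nleaves_sub _ _ _ CC).
Qed.

Lemma few_shift K n a C : (a <= n)%N ->
  few_leaves K n [seq (a + c)%N | c <- C] = few_leaves K (n - a) C.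
Proof. by move=> an; apply/seteqP; split=> t; rewrite /few_leaves /= nleaves_shift. Qed.

(** With at most [K] leaves and more than [K] starting points, two Z-chains end together; then a
    union bound over pairs. *)
Lemma few_far K n C (g : R) : 0 <= g -> (K < size C)%N ->
  pairwise (fun x y => `[< pr (meet n x y) <= g >]) C ->
  pr (few_leaves K n C) <= (size C)%:R ^+ 2 * g.
Proof.
move=> g0 KC pC.
pose clash D := [set t | ~~ uniq [seq landing (Z ^~ t) (n%:Z - c%:Z) | c <- D]].
have mclash D : measurable (clash D).
  apply: (@adapted_measurable n) => t t' zz _; rewrite /clash /=.
  suff -> : [seq landing (Z ^~ t) (n%:Z - c%:Z) | c <- D] =
    [seq landing (Z ^~ t') (n%:Z - c%:Z) | c <- D] by [].
  by apply: eq_map => c; apply: (landing_agree _ zz); lia.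
apply: (@le_trans _ _ (pr (clash C))).
  apply: pr_le => //; first exact: few_measurable.
  move=> t; rewrite /few_leaves /= => h; apply/negP => u.
  by have := nleaves_uniq_landing (Zp t) (Wp t) u; rewrite leqNgt (leq_ltn_trans h).
elim: C {KC} pC => [|c C IH].
  rewrite /clash /= (_ : [set _ | _] = set0) ?measure0 ?mulr_ge0 //.
  by apply/seteqP; split.
rewrite pairwise_cons => /andP[/allP cC /IH {}IH].
have mm i : i \in C -> measurable (meet n c i) by move=> _; exact: meet_measurable.
have mU : measurable (\big[setU/set0]_(i <- C) meet n c i).
  by rewrite big_seq; apply: bigsetU_measurable.
apply: (@le_trans _ _ (pr (\big[setU/set0]_(i <- C) meet n c i `|` clash C))).
  apply: pr_le => //; first exact: measurableU.
  move=> t; rewrite /clash /= negb_and negbK => /orP[/mapP[i iC e]|]; last by right.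
  by left; rewrite -bigcup_seq; exists i.
apply: le_trans (pr_setU mU (mclash _)) _.
apply: (@le_trans _ _ ((size C)%:R * g + (size C)%:R ^+ 2 * g)).
  apply: lerD => //; apply: le_trans (pr_bigsetU mm) _.
  apply: (@le_trans _ _ (\sum_(i <- C) g)).
    by rewrite big_seq [leRHS]big_seq; apply: ler_sum => i /cC /asboolP.
  by rewrite big_const_seq count_predT iter_addr_0 mulr_natl.
(* What remains is [s + s^2 <= (s + 1)^2]; the square generously bounds the number of pairs. *)
rewrite -mulrDl ler_wpM2r //= -natr1; have : 0 <= (size C)%:R :> R by [].
by move: (size C)%:R => s s0; nra.
Qed.

(** The splitting inequality at a fixed [n]. As [0] is not in [C], all points left after the split
    lie below [n], so their leaves are independent of [Z_n] and [W_n]. *)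
Lemma few_step K n A a b C (e0 e : R) : (0 < n)%N -> (0 < a <= A)%N -> (0 < b)%N ->
  0%N \notin C ->
  (forall k, (0 < k <= A)%N -> pr (few_leaves K n [:: k]) <= e0) ->
  pr (few_leaves K n [:: a, b & C]) <= e ->
  pr (few_leaves K n (0%N :: C)) <= tail A + ((1 - q a * q b) * e0 + q a * q b * e).
Proof.
case: n => // n _ /andP[a0 aA] b0 C0 he0 he.
have q0 := qlaw_ge0.
have e00 : 0 <= e0 by apply: le_trans (he0 a _); [exact: pr_ge0|rewrite a0].
have ad k : (0 < k)%N -> adapted n (few_leaves K n.+1 [:: k]).
  by move=> k0; apply: few_adapted => c; rewrite inE => /eqP ->; lia.
have adab : adapted n (few_leaves K n.+1 [:: a, b & C]).
  apply: few_adapted => c; rewrite !inE => /or3P[/eqP->|/eqP->|cC]; try lia.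
  by case: c cC => [cC|c _]; [rewrite cC in C0|lia].
have mZ k := Z_preimage_measurable n.+1 [set k].
have mW B := W_preimage_measurable n.+1 B.
pose H1 := few_leaves K n.+1 [:: a] `&` (Z n.+1 @^-1` [set a] `&` W n.+1 @^-1` ~` [set b]).
pose H2 := few_leaves K n.+1 [:: a, b & C] `&` (Z n.+1 @^-1` [set a] `&` W n.+1 @^-1` [set b]).
pose H k := if k == a then H1 `|` H2 else few_leaves K n.+1 [:: k] `&` Z n.+1 @^-1` [set k].
have mH1 : measurable H1 by apply: measurableI; [exact: few_measurable|exact: measurableI].
have mH2 : measurable H2 by apply: measurableI; [exact: few_measurable|exact: measurableI].
have mH k : measurable (H k).
  rewrite /H; case: ifP => _; first exact: measurableU.
  by apply: measurableI => //; exact: few_measurable.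
have sub1 t c D : (c \in D) -> few_leaves K n.+1 D t -> few_leaves K n.+1 [:: c] t.
  move=> cD; apply: leq_trans; apply: nleaves_sub => i; by rewrite inE => /eqP ->.
have EH t : few_leaves K n.+1 (0%N :: C) t -> H (Z n.+1 t) t.
  rewrite {1}/few_leaves /= nleaves_split // => h.
  have {}h : few_leaves K n.+1 [:: Z n.+1 t, W n.+1 t & C] t by [].
  rewrite /H; case: eqP => [za|_]; last by split=> //; apply: sub1 h; rewrite mem_head.
  rewrite za in h; have [wb|wb] := pselect (W n.+1 t = b).
    by right; rewrite wb in h.
  by left; split => //; apply: sub1 h; rewrite mem_head.
apply: le_trans (jump_cover A (few_measurable _ _ _) (fun k _ => mH k) EH) _.
rewrite lerD2l.
pose k1 := q a * q b.
have k10 : 0 <= k1 by rewrite mulr_ge0.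
have pH2 : pr H2 <= k1 * e.
  by rewrite /H2 ZW_step // mulrC ler_wpM2l.
have pH1 : pr H1 <= (q a - k1) * e0.
  rewrite /H1 adapted_indep //; last exact: ad.
  rewrite -preimage_setC probability_setC // Z_law W_law -EFinB -EFinM.
  rewrite fineM ?fin_num_measure //=; last exact: few_measurable.
  rewrite mulrC (_ : q a - k1 = q a * (1 - q b)); last by rewrite /k1; ring.
  by rewrite ler_wpM2l ?he0 ?a0 // mulr_ge0 // subr_ge0 qlaw_le1.
(* Every [k] contributes [q k * e0]; the indicator carries the correction at [k = a]. *)
apply: (@le_trans _ _ (\sum_(1 <= k < A.+1) (q k * e0 + (k == a)%:R * (k1 * e - k1 * e0)))).
  rewrite big_nat [leRHS]big_nat; apply: ler_sum => k /andP[k0 kA].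
  rewrite /H; case: eqP => [->|_].
    apply: le_trans (pr_setU mH1 mH2) _; rewrite mul1r.
    by have := lerD pH1 pH2; rewrite mulrBl; lra.
  rewrite mul0r addr0 (Z_step _ (ad _ k0)) mulrC ler_wpM2l // he0 // k0; lia.
rewrite big_split /= -!mulr_suml.
rewrite (_ : \sum_(1 <= k < A.+1) (k == a)%:R = 1 :> R); last first.
  rewrite (bigD1_seq a) ?iota_uniq ?mem_index_iota ?a0 //= eqxx big1 ?addr0 // => k /negPf -> //.
have := qlaw_sum_le1 A => /(ler_wpM2r e00); rewrite -/k1; lra.
Qed.

(** Stands for [limsup u <= e]; the slack of a true limsup appears as the explicit [eps] below. *)
Definition ultimately_le (u : nat -> R) (e : R) :=
  exists n0, forall n, (n0 <= n)%N -> u n <= e.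

Lemma ultimately_few_step K a b C (e0 e eps : R) : (0 < a)%N -> (0 < b)%N -> 0%N \notin C ->
  0 < eps ->
  ultimately_le (fun n => pr (few_leaves K n [:: 0%N])) e0 ->
  ultimately_le (fun n => pr (few_leaves K n [:: a, b & C])) e ->
  ultimately_le (fun n => pr (few_leaves K n (0%N :: C)))
    (eps + ((1 - q a * q b) * e0 + q a * q b * e)).
Proof.
move=> a0 b0 C0 eps0 [n0 h0] [n1 h1]; have [A0 hA] := tail_small eps0.
pose A := (A0 + a)%N; exists (n0 + n1 + A).+1 => n nn.
have tA : tail A <= eps by apply: hA; rewrite /A; lia.
apply: le_trans (@few_step K n A a b C e0 e _ _ b0 C0 _ _) _; rewrite ?lerD2r //.
- lia.
- rewrite /A; lia.
(* A single point at distance [k] is the top point for [n - k], so [e0] applies once [n] is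
   large. *)
- move=> k /andP[k0 kA]; have -> : [:: k] = [seq (k + c)%N | c <- [:: 0%N]].
    by rewrite /= addn0.
  by rewrite few_shift; [apply: h0; lia|lia].
- apply: h1; lia.
Qed.

(* [limsup h <= limsup H_C], with [h], [H_C] the probabilities of few leaves from
   [{n}] and from [{n} U (n - C)], in the quantitative form that needs no limsup;
   [C] is produced by repeatedly prescribing the jumps [(a, b)] at the top point. *)
Lemma ultimately_few_spread K a t m D : (0 < a)%N -> 0 < q a ->
  (forall B, exists2 b, (B <= b)%N & 0 < q b) ->
  exists C (k : R), [/\ size C = t, all (fun c => m < c)%N C,
    pairwise (fun x y => y + D <= x)%N C, 0 < k <= 1 &
    forall e0 e eps : R, 0 < eps ->
      ultimately_le (fun n => pr (few_leaves K n [:: 0%N])) e0 ->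
      ultimately_le (fun n => pr (few_leaves K n (0%N :: C))) e ->
      ultimately_le (fun n => pr (few_leaves K n [:: 0%N])) ((1 - k) * e0 + k * e + eps)].
Proof.
move=> a0 qa unb; elim: t m => [|t IH] m.
  exists [::], 1; split => //; first by rewrite ltr01 lexx.
  move=> e0 e eps eps0 _ [n0 h]; exists n0 => n /h hn.
  by apply: le_trans hn _; rewrite subrr mul0r add0r mul1r lerDl ltW.
have [C [k [sC mC pC /andP[k0 k1] hC]]] := IH (m + a)%N.
have [M Cb] : exists M, forall c, c \in C -> (c <= M)%N.
  by exists (\max_(c <- C) c)%N => c cC; exact: leq_bigmax_seq.
(* Unbounded support gives a [b] beyond the margin and at least [D] farther than every point of
   [C]. *)
have [b bB qb] := unb (m + a + D + M).+1.
have mab : (m + a < b)%N.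
  by apply: leq_trans bB; rewrite ltnS -addnA leq_addr.
have bC c : c \in C -> (c + D <= b)%N.
  move=> /Cb cM; apply: leq_trans (ltnW bB); rewrite addnC -!addnA.
  by rewrite addnA (leq_trans _ (leq_addl _ _)) // leq_add2l.
have [mC' pC' eC] := spread_cons mC pC mab bC.
have qab : 0 < q a * q b <= 1.
  by rewrite mulr_gt0 // mulr_ile1 ?qlaw_ge0 ?qlaw_le1.
case/andP: qab => qab0 qab1.
exists [seq (c - a)%N | c <- b :: C], (k * (q a * q b)); split.
- by rewrite size_map /= sC.
- by [].
- by [].
- by rewrite mulr_gt0 //= mulr_ile1 // ltW.
move=> e0 e eps eps0 h0 [n1 h1].
have b0 : (0 < b)%N by exact: leq_ltn_trans mab.
have C0 : 0%N \notin C by apply/negP => /(allP mC).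
have h2 : ultimately_le (fun n => pr (few_leaves K n [:: a, b & C])) e.
  exists (n1 + a)%N => n nn.
  have -> : [:: a, b & C] = [seq (a + c)%N | c <- 0%N :: [seq (c - a)%N | c <- b :: C]].
    by rewrite [RHS]map_cons addn0 -eC.
  have an : (a <= n)%N by exact: leq_trans (leq_addl _ _) nn.
  by rewrite few_shift //; apply: h1; rewrite leq_subRL // addnC.
(* Half of [eps] is spent in the induction hypothesis, half in the new step, which enters with
   weight [k <= 1]. *)
have e20 : 0 < eps / 2 by rewrite divr_gt0.
have [n2 h3] := hC _ _ _ e20 h0 (ultimately_few_step a0 b0 C0 e20 h0 h2).
exists n2 => n /h3 hn; apply: le_trans hn _.
by move: (q a * q b) qab0 qab1 => p p0 p1; nra.
Qed.

(** With slack [k * d'], the inequality maps a bound [u] to [(1 - k) * u + 2 * k * d'], a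
    contraction with fixed point [2 * d']. Iterating from the trivial bound 1 until
    [(1 - k) ^+ t <= d'] gives [3 * d' = e]. *)
Lemma few_leaves_vanish K a : (0 < a)%N -> 0 < q a ->
  (forall B, exists2 b, (B <= b)%N & 0 < q b) ->
  (forall g : R, 0 < g -> exists D, forall J x y, (x + D <= y)%N -> rcorr q J x y <= g) ->
  forall e : R, 0 < e -> ultimately_le (fun n => pr (few_leaves K n [:: 0%N])) e.
Proof.
move=> a0 qa unb far e e0.
pose d' := e / 3; have d0 : 0 < d' by rewrite divr_gt0.
pose s : R := K.+1%:R ^+ 2; have s0 : 0 < s by rewrite exprn_gt0.
have [D hD] := far _ (divr_gt0 d0 s0).
have [C [k [sC _ pC /andP[k0 k1] hC]]] := ultimately_few_spread K K.+1 0 D a0 qa unb.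
(* Forgetting the top point leaves [K + 1] points far apart, to which [few_far] applies with factor
   [s]. *)
have hd : ultimately_le (fun n => pr (few_leaves K n (0%N :: C))) d'.
  exists 0%N => n _; apply: (@le_trans _ _ (pr (few_leaves K n C))).
    by apply: few_sub => c cC; rewrite inE cC orbT.
  have -> : d' = (size C)%:R ^+ 2 * (d' / s) by rewrite sC mulrC divfK ?gt_eqF.
  apply: few_far; rewrite ?sC //; first by rewrite divr_ge0 // ltW.
  apply: sub_pairwise pC => x y xy; apply/asboolP; rewrite meetC.
  by apply: meet_far => J; exact: hD.
have kd0 : 0 < k * d' by rewrite mulr_gt0.
have iter t : ultimately_le (fun n => pr (few_leaves K n [:: 0%N])) (2 * d' + (1 - k) ^+ t).
  elim: t => [|t IH].
    exists 0%N => n _; apply: le_trans (pr_le1 (few_measurable _ _ _)) _.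
    by rewrite expr0 lerDr mulr_ge0 // ltW.
  have [n1 h1] := hC _ _ _ kd0 IH hd; exists n1 => n /h1 hn; apply: le_trans hn _.
  by rewrite exprS; move: (_ ^+ t) => p; lra.
have : `|1 - k| < 1 by rewrite ger0_norm ?subr_ge0 // gtrBl.
move=> /cvg_expr /cvgrPdist_le /(_ _ d0) [t _ ht].
have [n1 h1] := iter t; exists n1 => n /h1 hn; apply: le_trans hn _.
have := ht t (leqnn t); rewrite /= sub0r normrN => /(le_trans (ler_norm _)).
by rewrite /d'; move: (_ ^+ t) => p; lra.
Qed.

(** If [q] vanished from [B] on, [min(Z_1, W_1) <= Z_1 <= B] would hold almost surely and the
    expectation would be finite. *)
Lemma qlaw_unbounded :
  (\int[P]_x ((minn (Z 1%N x) (W 1%N x))%:R : R)%:E)%E = +oo%E ->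
  forall B, exists2 b, (B <= b)%N & 0 < q b.
Proof.
move=> Emin B; apply: contrapT => nB.
have qB b : (B <= b)%N -> q b = 0.
  move=> Bb; apply/eqP; rewrite eq_le qlaw_ge0 andbT leNgt; apply/negP => qb.
  by apply: nB; exists b.
have tB : P (Z 1 @^-1` [set k | (B < k)%N]) = 0%E.
  rewrite pr_fin ?Z_tail; last exact: Z_preimage_measurable.
  (* [tail] is constant from [B] on and tends to 0. *)
  congr EFin; apply/eqP; rewrite eq_le tail_ge0 andbT; apply/ler_addgt0Pr => e e0.
  rewrite add0r.
  have [A hA] := tail_small e0; apply: le_trans (hA (A + B)%N (leq_addr _ _)).
  rewrite /tail lerD2l lerN2 (@big_cat_nat _ _ _ B.+1) //=; last lia.
  by rewrite [X in _ + X]big_nat [X in _ + X]big1 ?addr0 // => i ?; apply: qB; lia.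
have : (\int[P]_x ((minn (Z 1%N x) (W 1%N x))%:R : R)%:E <= \int[P]_x (B%:R : R)%:E)%E.
  apply: ae_ge0_le_integral => //.
    (* The integrand is a function of the pair [(Z_1, W_1)], which has countable range. *)
    move=> _ Y mY; rewrite setTI.
    pose f x := (Z 1 x, W 1 x).
    rewrite (_ : _ @^-1` _ = f @^-1` [set p | Y ((minn p.1 p.2)%:R%:E)]) //.
    apply: measurable_countable_preimage => -[i j].
    rewrite (_ : [set _ | _] = [set x | Z 1 x = i] `&` [set x | W 1 x = j]).
      exact: measurableI.
    by apply/seteqP; split=> x /=; rewrite /f => -[-> ->].
  exists (Z 1 @^-1` [set k | (B < k)%N]); split => //; first exact: Z_preimage_measurable.
  move=> x /=; apply: contra_notP => /negP; rewrite -leqNgt => ZB _.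
  by rewrite lee_fin ler_nat geq_min ZB.
rewrite Emin integral_cst // [X in (_ * X)%E](_ : _ = 1%E); last exact: probability_setT.
by rewrite mule1.
Qed.

End Jumps.

(** * Use of the square summability, and conclusion *)

Lemma nneseries_bounded_tail (R : realType) (u : nat -> R) : (forall n, 0 <= u n) ->
  (\sum_(0 <= n <oo) (u n)%:E < +oo)%E ->
  exists S : R, (forall n, \sum_(i < n) u i <= S) /\
    forall e, 0 < e -> exists D, forall n, \sum_(D <= i < n) u i <= e.
Proof.
move=> u0; set L := (\sum_(0 <= n <oo) _)%E => Loo.
have uE n : (0 <= (u n)%:E)%E by rewrite lee_fin.
have L0 : (0 <= L)%E by apply: nneseries_ge0.
have LE : L = (fine L)%:E by rewrite fineK // ge0_fin_numE.
have part n : \sum_(0 <= i < n) u i <= fine L.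
  by rewrite -lee_fin -LE -sumEFin; apply: nneseries_lim_ge.
exists (fine L); split=> [n|e e0]; first by rewrite -(big_mkord xpredT u).
have : (fun n => (\sum_(0 <= i < n) (u i)%:E)%E) @ \oo --> L by apply: is_cvg_nneseries.
rewrite LE => /fine_cvgP[_ /cvgrPdist_le /(_ _ e0)[D _ hD]].
exists D => n; have := hD D (leqnn D); rewrite /= sumEFin /=.
have [Dn|nD] := leqP D n; last by rewrite [X in _ -> X <= _]big_geq ?(ltW e0) // ltnW.
move=> /(le_trans (ler_norm _)) h.
have := part n; rewrite (@big_cat_nat _ _ _ D) //= => h'; lra.
Qed.

Lemma rcorr_small (R : realType) (q : nat -> R) : (forall k, 0 <= q k) ->
  (\sum_(0 <= n <oo) ((rseq q n) ^+ 2)%:E < +oo)%E ->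
  forall g : R, 0 < g -> exists D, forall J x y, (x + D <= y)%N -> rcorr q J x y <= g.
Proof.
move=> q0 /nneseries_bounded_tail[n|S [hS ht] g g0]; first exact: sqr_ge0.
have S0 : 0 <= S by have := hS 0%N; rewrite big_ord0.
have S1 : 0 < S + 1 by rewrite ltr_wpDl.
(* The solution of [e * (S + 1) / 2 = g], to match [rcorr_far]. *)
pose e := g * 2 / (S + 1); have e0 : 0 < e by rewrite divr_gt0 // mulr_gt0.
have [D hD] := ht (e ^+ 2) (exprn_gt0 _ e0); exists D => J x y xy.
have -> : g = e * (S + 1) / 2 by rewrite /e; field; rewrite gt_eqF.
exact: rcorr_far e0 xy hS hD.
Qed.

Theorem theorem6 (R : realType) (d : measure_display) (T : measurableType d)
  (P : probability T R) (Z W : nat -> T -> nat)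
  (Zmeas : forall n (k : nat), measurable [set x | Z n x = k])
  (Wmeas : forall n (k : nat), measurable [set x | W n x = k])
  (Zpos : forall n x, (0 < n)%N -> (0 < Z n x)%N)
  (Wpos : forall n x, (0 < n)%N -> (0 < W n x)%N)
  (indep : mutually_independent P (ZWfam Z W))
  (iid : identically_distributed P (ZWfam Z W))
  (Emin : (\int[P]_x ((minn (Z 1%N x) (W 1%N x))%:R : R)%:E)%E = +oo%E)
  (r2sum : (\sum_(0 <= n <oo) ((rseq (qlaw P (Z 1%N)) n) ^+ 2)%:E < +oo)%E) :
  forall K : nat,
    (fun n => P [set x | (Lambda Z W n x <= K)%N]) @ \oo --> 0%E.
Proof.
move=> K.
have unb : forall B, exists2 b, (B <= b)%N & 0 < qlaw P (Z 1%N) b.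
  exact: qlaw_unbounded Emin.
have [a a0 qa] := unb 1%N.
have lim (e : R) : 0 < e -> exists n0, forall n, (n0 <= n)%N ->
    fine (P (few_leaves Z W K n [:: 0%N])) <= e.
  apply: few_leaves_vanish a0 qa unb _ e => // g; apply: rcorr_small => //.
  exact: qlaw_ge0.
have fewE n : [set x | (Lambda Z W n x <= K)%N] = few_leaves Z W K n [:: 0%N].
  by apply/seteqP; split=> x; rewrite /few_leaves /= Lambda_nleaves.
have mf n : measurable (few_leaves Z W K n [:: 0%N]) by exact: few_measurable.
apply/fine_cvgP; split.
  by exists 0%N => // n _; rewrite fewE fin_num_measure.
apply/cvgrPdist_le => e e0; have [N hN] := lim e e0.
exists N => // n Nn; rewrite /= fewE sub0r normrN ger0_norm; first exact: hN.
exact: pr_ge0.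
Qed.
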